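(* Let $n\ge2$ and let $\mathcal{S}=\{s_i\}_{i\ge1}$ be a uniformly relatively separated sequence of slits in a bounded open box $I=(a_1,b_1)\times\cdots\times(a_n,b_n)\subset\mathbb{R}^n$. Suppose there exists $\varepsilon>0$ for which there is a subsequence $\mathcal{S}(\varepsilon)=\{s_{i_k(\varepsilon)}\}_{k=1}^\infty$ of $\mathcal{S}$ such that $$s_{i_k(\varepsilon)}^{\varepsilon}\cap s_{i_l(\varepsilon)}^{\varepsilon}=\emptyset,\qquad k\ne l .$$ Then there is a constant $C_n>0$ (depending only on $n$) such that for every $p\ge1$ $$\mathrm{mod}_p\,\Gamma_{\mathcal{S}}\le (b_1-a_1)^{-p}\left[\mathcal{H}^n(\mathcal{R}^{\varepsilon})+C_n\,\mathcal{H}^n(I)\,\varepsilon\right],$$ where $\mathcal{R}^{\varepsilon}=I\setminus\bigcup_{k=1}^\infty s_{i_k(\varepsilon)}^{\varepsilon}$.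
   Context: A slit in $I$ is a set $s=\{x\}\times[c_2,d_2]\times\cdots\times[c_n,d_n]\subset I$ with $d_2-c_2=\dots=d_n-c_n=:l(s)>0$. The slits in a sequence are assumed pairwise disjoint. The sequence $\mathcal{S}$ is uniformly relatively separated in $I$ if there is $\sigma>0$ with $\Delta(s_i,s_j)\ge\sigma$ and $\Delta(s_i,\partial I)\ge\sigma$ for all $i\ne j$, where $\Delta(E,F)=\mathrm{dist}(E,F)/\min(\mathrm{diam}\,E,\mathrm{diam}\,F)$. It is a standing assumption of the paper that also $\mathrm{diam}(s_i)\to0$ and $\bigcup_i s_i$ is dense in $I$. For $\varepsilon>0$ the (right) $\varepsilon$-collar of a slit $s=\{x\}\times[c_2,d_2]\times\cdots\times[c_n,d_n]$ is $s^\varepsilon=(x,x+\varepsilon l(s))\times[c_2,d_2]\times\cdots\times[c_n,d_n]$. Let $L=\{a_1\}\times(a_2,b_2)\times\cdots\times(a_n,b_n)$ and $R=\{b_1\}\times(a_2,b_2)\times\cdots\times(a_n,b_n)$. A curve $\gamma:(0,1)\to X$ connects $E$ and $F$ if $E\cup F\cup\overline\gamma$ is connected, $\overline\gamma$ being the closure of the image of $\gamma$ in $X$. Let $S_i=I\setminus\bigcup_{j\le i}s_j$, $\Gamma_i=\{\gamma\subset S_i: \gamma \text{ connects } L \text{ to } R \text{ in } \overline I\}$ and $\Gamma_{\mathcal{S}}=\bigcap_{i\ge1}\Gamma_i$, i.e. the family of curves in $I$ connecting $L$ and $R$ that avoid all the slits. For $p\ge1$, the $p$-modulus of a curve family $\Gamma$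 in $(X,\mu)$ is $\mathrm{mod}_p\Gamma=\inf_\rho\int_X\rho^p\,d\mu$ over all Borel $\rho:X\to[0,\infty)$ with $\int_\gamma\rho\,ds\ge1$ for every locally rectifiable $\gamma\in\Gamma$; here it is taken in $\mathbb{R}^n$ with respect to Hausdorff measure $\mathcal{H}^n$ (Lebesgue measure). *)

(* Defs.v *)
From HB Require Import structures.
From mathcomp Require Import all_boot all_order all_algebra.
From mathcomp Require Import all_classical all_reals all_analysis.

Set Implicit Arguments.
Unset Strict Implicit.
Unset Printing Implicit Defensive.

Import Order.TTheory GRing.Theory Num.Theory.
Import numFieldNormedType.Exports.

Local Open Scope classical_set_scope.
Local Open Scope ring_scope.

(* 'rV[R]_n with the sigma-algebra generated by its open sets. The topology of
   'rV[R]_n is the product topology, i.e. the Euclidean one. *)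
Definition borel_rV (R : realType) (n : nat) :=
  g_sigma_algebraType [set U : set 'rV[R]_n | open U].

Section lebesgue_cons.
Context (R : realType) (n : nat).
Variable mu : {sigma_finite_measure set (n.-tuple (measurableTypeR R)) -> \bar R}.

Local Notation T := (n.-tuple (measurableTypeR R)).
Local Notation T1 := (n.+1.-tuple (measurableTypeR R)).

Definition tuple_cons (x : measurableTypeR R * T) : T1 := [tuple of x.1 :: x.2].
Definition tuple_uncons (t : T1) : measurableTypeR R * T :=
  (thead t, [tuple of behead t]).

Lemma measurable_tuple_cons : measurable_fun setT tuple_cons.
Proof. exact: measurable_cons. Qed.

Lemma measurable_tuple_uncons : measurable_fun setT tuple_uncons.
Proof.
apply/measurable_fun_pairP; split => /=.
  exact: measurable_tnth.
exact: measurable_behead.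
Qed.

Lemma tuple_consK : cancel tuple_cons tuple_uncons.
Proof. by move=> [x t]; congr pair; exact/val_inj. Qed.

Lemma tuple_unconsK : cancel tuple_uncons tuple_cons.
Proof. by move=> t; rewrite [RHS]tuple_eta. Qed.

Definition lebesgue_cons : set T1 -> \bar R :=
  pushforward (@lebesgue_measure R \x mu)%E tuple_cons.

Let measurable_tuple_cons_preimage (A : set T1) :
  measurable A -> measurable (tuple_cons @^-1` A).
Proof. by move=> mA; rewrite -[X in measurable X]setTI; exact: measurable_tuple_cons. Qed.

Let lebesgue_cons0 : lebesgue_cons set0 = 0%E.
Proof. by rewrite /lebesgue_cons /pushforward preimage_set0 measure0. Qed.

Let lebesgue_cons_ge0 A : (0 <= lebesgue_cons A)%E.
Proof. by rewrite /lebesgue_cons /pushforward measure_ge0. Qed.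

Let lebesgue_cons_sigma_additive : semi_sigma_additive lebesgue_cons.
Proof.
move=> F mF tF mUF; rewrite /lebesgue_cons /pushforward preimage_bigcup.
apply: measure_semi_sigma_additive.
- by move=> i; exact: measurable_tuple_cons_preimage.
- apply/trivIsetP => /= i j _ _ ij; rewrite -preimage_setI.
  by move/trivIsetP : tF => /(_ _ _ _ _ ij) ->//; rewrite preimage_set0.
- by rewrite -preimage_bigcup; exact: measurable_tuple_cons_preimage.
Qed.

HB.instance Definition _ := isMeasure.Build _ _ _ lebesgue_cons
  lebesgue_cons0 lebesgue_cons_ge0 lebesgue_cons_sigma_additive.

Let lebesgue_cons_sigma_finite : sigma_finite setT lebesgue_cons.
Proof.
have /sigma_finiteP[F [TF ndF Foo]] := sigma_finiteT (@lebesgue_measure R).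
have /sigma_finiteP[G [TG ndG Goo]] := sigma_finiteT mu.
have mFG k : measurable (F k `*` G k).
  by apply: measurableX; [case: (Foo k)|case: (Goo k)].
exists (fun k => tuple_uncons @^-1` (F k `*` G k)).
  rewrite -preimage_bigcup (_ : \bigcup_k _ = setT) ?preimage_setT//.
  apply/seteqP; split => // -[x t] _.
  have [/= k _ Fx] : (\bigcup_k F k) x by rewrite -TF.
  have [/= m _ Gt] : (\bigcup_k G k) t by rewrite -TG.
  exists (maxn k m) => //; split => /=.
    by move: x Fx; exact/subsetPset/ndF/leq_maxl.
  by move: t Gt; exact/subsetPset/ndG/leq_maxr.
move=> k; split.
  by rewrite -[X in measurable X]setTI; exact: measurable_tuple_uncons.
rewrite /lebesgue_cons /pushforward -comp_preimage.
rewrite (_ : tuple_uncons \o tuple_cons = id); last first.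
  by apply/funext => x /=; rewrite tuple_consK.
have [mF Foo'] := Foo k; have [mG Goo'] := Goo k.
by rewrite preimage_id product_measure1E// lte_mul_pinfty// ge0_fin_numE.
Qed.

HB.instance Definition _ := Measure_isSigmaFinite.Build _ _ _ lebesgue_cons
  lebesgue_cons_sigma_finite.

End lebesgue_cons.

Fixpoint lebesgue_tuple (R : realType) (n : nat) :
    {sigma_finite_measure set (n.-tuple (measurableTypeR R)) -> \bar R} :=
  match n with
  | 0 => @dirac _ _ ([tuple] : 0.-tuple (measurableTypeR R)) R
  | m.+1 => lebesgue_cons (lebesgue_tuple R m)
  end.

Section lebesgue_rV.
Context (R : realType) (n : nat).

Definition rV_of_tuple (t : n.-tuple (measurableTypeR R)) : borel_rV R n :=
  (\row_i (tnth t i : R)).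

Let measurable_rV_of_tuple_ball (x : 'rV[R]_n) (e : R) :
  measurable (rV_of_tuple @^-1` ball x e).
Proof.
have [e0|e0] := ltP 0 e; last first.
  rewrite (_ : _ @^-1` _ = set0)//; apply/seteqP; split => // t /=.
  by case; rewrite ltNge e0.
rewrite (_ : _ @^-1` _ = \bigcap_(i in [set: 'I_n])
    ((@tnth n (measurableTypeR R))^~ i @^-1` ball (x ord0 i) e)).
  apply: fin_bigcap_measurable => [|i _]; first exact: finite_finset.
  rewrite -[X in measurable X]setTI; apply: measurable_tnth => //.
  by rewrite ball_itv; exact: measurable_itv.
apply/seteqP; split => t /=.
  by case=> _ h i _; have := h ord0 i; rewrite /= mxE.
by move=> h; split => // i j; rewrite ord1 mxE; exact: h.
Qed.

Lemma measurable_rV_of_tuple : measurable_fun setT rV_of_tuple.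
Proof.
apply: (@measurability _ _ _ (borel_rV R n) setT rV_of_tuple
  [set U : set 'rV[R]_n | open U]) => //.
move=> _ [U /= oU <-]; rewrite setTI.
pose B (qk : n.-tuple rat * nat) : set 'rV[R]_n :=
  ball (\row_i ratr (tnth qk.1 i) : 'rV[R]_n) qk.2.+1%:R^-1.
pose P := [set qk | B qk `<=` U].
rewrite (_ : U = \bigcup_(qk in P) B qk); last first.
  apply/seteqP; split => [x Ux|x [qk Pqk]]; last exact: Pqk.
  move: oU; rewrite openE => /(_ _ Ux); rewrite /interior -nbhs_ballE.
  case=> e /= e0 xeU.
  have [k] := ltr_add_invr (divr_gt0 e0 (ltr0n _ 2)); rewrite add0r => ke.
  have k0 : 0 < k.+1%:R^-1 :> R by rewrite invr_gt0.
  have /choice[q qP] (i : 'I_n) :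
      exists q : rat, ball (x ord0 i) k.+1%:R^-1 (ratr q : R).
    have /rat_in_itvoo[q] : x ord0 i - k.+1%:R^-1 < x ord0 i + k.+1%:R^-1.
      by rewrite ltrD2l gtrN.
    by rewrite in_itv /= => qx; exists q; rewrite ball_itv.
  exists ([tuple q i | i < n], k); last first.
    by split => // i j; rewrite ord1 mxE tnth_mktuple; exact/ball_sym/qP.
  move=> y [_ By]; apply: xeU; split => // i j; rewrite (splitr e).
  rewrite ord1; apply: (@ball_triangle _ R (ratr (q j)) (x ord0 j) (y ord0 j)); apply: le_ball (ltW ke) _ _.
    exact: qP.
  by have := By ord0 j; rewrite mxE tnth_mktuple.
rewrite preimage_bigcup bigcup_mkcond.
apply: countable_bigcupT_measurable => // qk; case: ifP => // _.
exact: measurable_rV_of_tuple_ball.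
Qed.

(* n-fold product of the one-dimensional Lebesgue measure; it is the Hausdorff
   measure H^n normalized so that the unit cube has measure 1. *)
Definition lebesgue_rV : set (borel_rV R n) -> \bar R :=
  pushforward (lebesgue_tuple R n) rV_of_tuple.

Let measurable_rV_of_tuple_preimage (A : set (borel_rV R n)) :
  measurable A -> measurable (rV_of_tuple @^-1` A).
Proof.
by move=> mA; rewrite -[X in measurable X]setTI; exact: measurable_rV_of_tuple.
Qed.

Let lebesgue_rV0 : lebesgue_rV set0 = 0%E.
Proof. by rewrite /lebesgue_rV /pushforward preimage_set0 measure0. Qed.

Let lebesgue_rV_ge0 A : (0 <= lebesgue_rV A)%E.
Proof. by rewrite /lebesgue_rV /pushforward measure_ge0. Qed.

Let lebesgue_rV_sigma_additive : semi_sigma_additive lebesgue_rV.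
Proof.
move=> F mF tF mUF; rewrite /lebesgue_rV /pushforward preimage_bigcup.
apply: measure_semi_sigma_additive.
- by move=> i; exact: measurable_rV_of_tuple_preimage.
- apply/trivIsetP => /= i j _ _ ij; rewrite -preimage_setI.
  by move/trivIsetP : tF => /(_ _ _ _ _ ij) ->//; rewrite preimage_set0.
- by rewrite -preimage_bigcup; exact: measurable_rV_of_tuple_preimage.
Qed.

HB.instance Definition _ := isMeasure.Build _ _ _ lebesgue_rV
  lebesgue_rV0 lebesgue_rV_ge0 lebesgue_rV_sigma_additive.

End lebesgue_rV.

Arguments lebesgue_rV {R n}.

Lemma lebesgue_tuple_prod (R : realType) (n : nat)
    (J : 'I_n -> set (measurableTypeR R)) : (forall i, measurable (J i)) ->
  lebesgue_tuple R n [set t | forall i, J i (tnth t i)] =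
  (\prod_(i < n) lebesgue_measure (J i))%E.
Proof.
elim: n J => [|n ih] J mJ.
  rewrite big_ord0 /= diracE mem_set//= => -[].
  by [].
rewrite big_ord_recl /= /lebesgue_cons /pushforward -ih// -product_measure1E//.
  congr (_ _); apply/seteqP; split => -[x t] /=.
    move=> h; split => [|i]; first by have := h ord0.
    by have := h (lift ord0 i); rewrite tnthS; congr (J _ (tnth _ _)); exact/val_inj.
  move=> [h0 h] i; case: (unliftP ord0 i) => [j ->|->]; last exact: h0.
  by rewrite tnthS; have := h j; congr (J _ (tnth _ _)); exact/val_inj.
rewrite (_ : [set t | _] = \bigcap_(i in [set: 'I_n])
    ((@tnth n (measurableTypeR R))^~ i @^-1` J (lift ord0 i))).
  apply: fin_bigcap_measurable => [|i _]; first exact: finite_finset.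
  by rewrite -[X in measurable X]setTI; apply: measurable_tnth.
by apply/seteqP; split => t /= h i; [move=> _|]; exact: h.
Qed.

Lemma lebesgue_rV_prod (R : realType) (n : nat)
    (J : 'I_n -> set (measurableTypeR R)) : (forall i, measurable (J i)) ->
  lebesgue_rV [set x : 'rV[R]_n | forall i, J i (x ord0 i)] =
  (\prod_(i < n) lebesgue_measure (J i))%E.
Proof.
move=> mJ; rewrite -lebesgue_tuple_prod// /lebesgue_rV /pushforward.
congr (_ _); apply/seteqP; split => t /= h i; have := h i; by rewrite mxE.
Qed.

Section euclidean.
Context (R : realType) (n : nat).
Implicit Types (x y : 'rV[R]_n) (E F : set 'rV[R]_n).

(* `|x| is the sup norm of the row vector x. *)
Definition norm2 x : R := Num.sqrt (\sum_i x ord0 i ^+ 2).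

Definition dist2 E F : R :=
  inf [set norm2 (xy.1 - xy.2) | xy in E `*` F].

Definition diam2 E : R :=
  sup [set norm2 (xy.1 - xy.2) | xy in E `*` E].

Definition rel_dist E F : R := dist2 E F / Num.min (diam2 E) (diam2 F).

Definition frontier E : set 'rV[R]_n := closure E `\` interior E.

End euclidean.

Section curves.
Context (R : realType) (n : nat).
(* A curve is a map on ]0, 1[, represented by a function on R whose values
   outside ]0, 1[ are irrelevant. *)
Implicit Types (g : R -> 'rV[R]_n) (rho : 'rV[R]_n -> R).

Definition is_curve g : Prop := {within `]0, 1[, continuous g}.

Definition curve_image g : set 'rV[R]_n := g @` `]0, 1[.

(* [closure _ `&` X] is the closure in the subspace X. *)
Definition connects (X E F : set 'rV[R]_n) g : Prop :=
  connected (E `|` F `|` (closure (curve_image g) `&` X)).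

Definition polygonal_length g (a b : R) (s : seq R) : R :=
  let G := g \o nth b (a :: s) in
  \sum_(0 <= k < size s) norm2 (G k.+1 - G k).

Definition curve_length g (a b : R) : \bar R :=
  ereal_sup [set (polygonal_length g a b s)%:E | s in itv_partition a b].

Definition locally_rectifiable g : Prop :=
  forall a b : R, 0 < a -> a <= b -> b < 1 -> (curve_length g a b < +oo)%E.

(* Arc length parametrization of the restriction of g to [a, b]: its value at t
   is g u for any u in [a, b] such that g has length t on [a, u]. It does not
   depend on the choice of u, since g is constant between two such points. *)
Definition arc_param g (a b : R) (t : R) : 'rV[R]_n :=
  g (get [set u | a <= u <= b /\ curve_length g a u = t%:E]).

Definition line_integral_seg rho g (a b : R) : \bar R :=
  (\int[lebesgue_measure]_(t in `[0%R, fine (curve_length g a b)])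
    (rho (arc_param g a b t))%:E)%E.

Definition line_integral rho g : \bar R :=
  ereal_sup [set line_integral_seg rho g ab.1 ab.2 |
             ab in [set ab : R * R | [/\ 0 < ab.1, ab.1 <= ab.2 & ab.2 < 1]]].

Definition admissible (G : set (R -> 'rV[R]_n)) rho : Prop :=
  [/\ forall x, 0 <= rho x,
      measurable_fun setT (rho : borel_rV R n -> measurableTypeR R) &
      forall g, G g -> locally_rectifiable g -> (1 <= line_integral rho g)%E].

Definition modulus (p : R) (G : set (R -> 'rV[R]_n)) : \bar R :=
  ereal_inf [set (\int[lebesgue_rV]_x (rho x `^ p)%:E)%E | rho in admissible G].

End curves.

(* The ambient space is R^(n+1), so that the first coordinate is [ord0]. *)
Section slits.
Context (R : realType) (n : nat).
Local Notation V := 'rV[R]_n.+1.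
Implicit Types (a b : V).

Definition open_box a b : set V :=
  [set x | forall i, a ord0 i < x ord0 i < b ord0 i].

Definition left_face a b : set V :=
  [set x | x ord0 ord0 = a ord0 ord0 /\
           forall i, i != ord0 -> a ord0 i < x ord0 i < b ord0 i].

Definition right_face a b : set V :=
  [set x | x ord0 ord0 = b ord0 ord0 /\
           forall i, i != ord0 -> a ord0 i < x ord0 i < b ord0 i].

(* The slit {x} * [c_2, c_2 + l] * ... * [c_n, c_n + l] is given by its corner
   (x, c_2, ..., c_n) and its side length l. *)
Record slit := Slit {
  slit_corner : V ;
  slit_length : R ;
  slit_length_gt0 : 0 < slit_length }.

Definition slit_fiber (s : slit) : set V :=
  [set z | forall i, i != ord0 -> slit_corner s ord0 i <= z ord0 i
                                  <= slit_corner s ord0 i + slit_length s].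

Definition slit_set (s : slit) : set V :=
  [set z : V | z ord0 ord0 = slit_corner s ord0 ord0] `&` slit_fiber s.

Definition collar (e : R) (s : slit) : set V :=
  [set z : V | slit_corner s ord0 ord0 < z ord0 ord0
           < slit_corner s ord0 ord0 + e * slit_length s] `&` slit_fiber s.

(* Sequences are indexed from 0. *)
Implicit Types (S : nat -> slit) (I : set V).

Definition slit_sequence I S : Prop :=
  [/\ forall i, slit_set (S i) `<=` I,
      forall i j, i != j -> slit_set (S i) `&` slit_set (S j) = set0,
      diam2 (slit_set (S i)) @[i --> \oo] --> (0 : R) &
      I `<=` closure (\bigcup_i slit_set (S i))].

Definition uniformly_rel_separated I S : Prop :=
  exists2 sigma : R, 0 < sigma &
    (forall i j, i != j -> sigma <= rel_dist (slit_set (S i)) (slit_set (S j))) /\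
    (forall i, sigma <= rel_dist (slit_set (S i)) (frontier I)).

Definition slit_domain a b S (i : nat) : set V :=
  open_box a b `\` \bigcup_(j in [set j | (j <= i)%N]) slit_set (S j).

Definition curve_family_upto a b S (i : nat) : set (R -> V) :=
  [set g | [/\ is_curve g, curve_image g `<=` slit_domain a b S i &
      connects (closure (open_box a b)) (left_face a b) (right_face a b) g]].

Definition curve_family a b S : set (R -> V) :=
  \bigcap_i curve_family_upto a b S i.

Definition collar_complement a b S (e : R) (k : nat -> nat) : set V :=
  open_box a b `\` \bigcup_m collar e (S (k m)).

End slits.

(* Main.v *)
Require Import Defs.
From mathcomp Require Import all_boot all_order all_algebra.
From mathcomp Require Import all_classical all_reals all_analysis.
From mathcomp Require Import measurable_realfun ring lra.

Import Order.TTheory GRing.Theory Num.Theory.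
Import numFieldNormedType.Exports.

Local Open Scope classical_set_scope.
Local Open Scope ring_scope.

(** The bound is obtained from one density, [rho = 1_A / (b_1 - a_1)], where [A]
    is the box minus the cores of the collars. The core of the collar of a slit
    with corner [(x, c_2, ..., c_n)] and side [l] consists of the points of the
    collar at distance at least [e l] from its lateral faces. A collar has
    dimensions [e l], [l], ..., [l], so in dimension [n] what lies between the
    collar and its core is covered by [2 (n - 1)] slabs, whose volume is [e] times
    that of the collar. The collars being disjoint, these margins add at most
    [2 (n - 1) e H^n(I)] to the volume of the complement of the collars, and
    [mod_p <= int rho^p] is the asserted bound ([box_cores_volume],
    [modulus_le_volume]).

    It remains to see that [rho] is admissible: a curve that joins the left face
    to the right face and avoids the slits spends length at least [b_1 - a_1] in
    [A]. The cores are free of charge, so one must exclude that a curve gains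
    horizontal distance by crossing them. A curve cannot enter a core from the
    left, because the slit is in the way; if it enters through a lateral face, it
    pays [e l] in the margin, which is all that it can gain in the core. This is
    expressed by a potential [F]. On the wedge
    [{x < z_1 < x + min (e l, lateral depth of z)}] of each slit it is
    [x + min (e l, lateral depth of z)], and elsewhere it is the first coordinate
    [z_1]. It is constant on each core, and it is continuous except across the
    slits, since on the rest of the boundary of a wedge both formulas agree.

    Along a curve that avoids the slits, [F] is 1-Lipschitz for arc length
    ([potential_lipschitz]): both formulas are 1-Lipschitz in space, so for two
    points in different wedges it is enough to stop at the first exit from the
    wedge of the first point and at the last entrance in that of the second one.
    This takes no account of the other, possibly infinitely many, wedges met in
    between.

    Let [h] be [F] composed with the arc length parametrization on [[0, L]]. By
    continuity [h] takes all the values between [h 0] and [h L]; it takes only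
    countably many of them in the cores, and a 1-Lipschitz function does not
    increase the measure of the set of the remaining parameters. So
    [|h L - h 0|] is at most the length that the curve spends in [A]
    ([lipschitz_oscillation_le_measure], [potential_gap_le_integral]). Finally
    [F >= z_1], which is close to [b_1] somewhere on the curve, and [F] is close to
    [z_1] near the left face: a wedge that reaches there belongs to a slit close
    to the face, and these are small because the diameters of the slits tend
    to 0.

    Integration along the curve uses its arc length parametrization, which reaches
    every parameter because arc length is a continuous function
    ([curve_length_continuous]); this follows from the continuity of the total
    variation of each coordinate. *)

Set Implicit Arguments.
Unset Strict Implicit.
Unset Printing Implicit Defensive.

(** * Euclidean norm *)

Section euclidean_norm.
Context {R : realType} {n : nat}.
Implicit Types x y : 'rV[R]_n.

Lemma norm2_ge0 x : 0 <= norm2 x.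
Proof. exact: sqrtr_ge0. Qed.

Lemma sqr_norm2 x : norm2 x ^+ 2 = \sum_i x ord0 i ^+ 2.
Proof. by rewrite sqr_sqrtr// sumr_ge0// => i _; exact: sqr_ge0. Qed.

Lemma le_norm2 x r : 0 <= r -> \sum_i x ord0 i ^+ 2 <= r ^+ 2 -> norm2 x <= r.
Proof. by move=> r0 xr; rewrite -(@ler_pXn2r _ 2) ?nnegrE ?norm2_ge0// sqr_norm2. Qed.

Lemma norm20 : norm2 (0 : 'rV[R]_n) = 0.
Proof. by rewrite /norm2 big1 ?sqrtr0// => i _; rewrite mxE expr0n. Qed.

Lemma coord_le_norm2 x i : `|x ord0 i| <= norm2 x.
Proof.
rewrite -(@ler_pXn2r _ 2) ?nnegrE ?norm2_ge0// sqr_norm2 real_normK ?num_real//.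
by rewrite (bigD1 i)//= lerDl sumr_ge0// => j _; exact: sqr_ge0.
Qed.

(** A triangle inequality with the l^1 norm of the second term, the form in which
    arc length compares with the variations of the coordinates. *)
Lemma norm2D_le_sum x y : norm2 (x + y) <= norm2 x + \sum_i `|y ord0 i|.
Proof.
set T := \sum_i _; have T0 : 0 <= T by rewrite sumr_ge0.
apply: le_norm2; first by rewrite addr_ge0// norm2_ge0.
have -> : (norm2 x + T) ^+ 2 = \sum_i (x ord0 i ^+ 2 + (norm2 x *+ 2 + T) * `|y ord0 i|).
  by rewrite big_split/= -sqr_norm2 -mulr_sumr -/T; ring.
apply: ler_sum => i _; rewrite mxE sqrrD -addrA lerD2l mulrDl mulrnAl lerD//.
  rewrite lerMn2r/= (le_trans (ler_norm _))// normrM ler_wpM2r//.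
  exact: coord_le_norm2.
rewrite -real_normK ?num_real// expr2 ler_wpM2r//.
by rewrite /T (bigD1 i)//= lerDl sumr_ge0.
Qed.

Lemma norm2_le_sum x : norm2 x <= \sum_i `|x ord0 i|.
Proof. by have := norm2D_le_sum 0 x; rewrite add0r norm20 add0r. Qed.
End euclidean_norm.

(** * Sums along a subdivision *)

Section chain.
Context {R : realType}.
Implicit Types (d : R -> R -> R) (a b : R) (s : seq R).

(** The recursive form of the sums over consecutive points that define polygonal
    lengths and variations; it makes inductions on the subdivision immediate. *)
Fixpoint chain d a s : R := if s is x :: s' then d a x + chain d x s' else 0.

Lemma chainE d a b s :
  \sum_(0 <= k < size s) d (nth b (a :: s) k) (nth b (a :: s) k.+1) = chain d a s.
Proof.
elim: s a => [|x s ih] a /=; first by rewrite big_nil.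
by rewrite big_nat_recl//= -ih.
Qed.

Lemma chain_rcons d a s x : chain d a (rcons s x) = chain d a s + d (last a s) x.
Proof. by elim: s a => [|y s ih] a /=; rewrite ?addr0 ?add0r// ih addrA. Qed.

Lemma le_chain d1 d2 a s : (forall x y, d1 x y <= d2 x y) ->
  chain d1 a s <= chain d2 a s.
Proof. by move=> h; elim: s a => //= x s ih a; rewrite lerD. Qed.

Lemma chain_sum (I : finType) (d : I -> R -> R -> R) a s :
  chain (fun x y => \sum_i d i x y) a s = \sum_i chain (d i) a s.
Proof. by elim: s a => [|x s ih] a /=; [rewrite big1|rewrite ih -big_split]. Qed.

(** Inserting a point in a subdivision splits its chain in two; to the right of
    the point one may change to the larger [d2], for which only the mixed triangle
    inequality is available. *)
Lemma chain_insert d1 d2 a s u :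
    (forall x y z, d1 x z <= d1 x y + d2 y z) ->
    (forall x z, d1 x z <= d2 x z) ->
    (forall x, 0 <= d1 x x) ->
  path <%R a s -> a <= u <= last a s ->
  exists s1 s2, [/\ itv_partition a u s1, itv_partition u (last a s) s2 &
    chain d1 a s <= chain d1 a s1 + chain d2 u s2].
Proof.
move=> d12 d1d2 d1xx; elim: s a => [|x s ih] a /=.
  move=> _ /andP[au ua]; exists [::], [::]; rewrite /itv_partition/= addr0.
  have -> : a = u by apply: le_anti; rewrite au.
  by [].
move=> /andP[ax xs] /andP[au ul]; have [xu|ux|xu] := ltgtP u x; last first.
- subst u; exists [:: x], s; rewrite /itv_partition/= ax xs addr0 eqxx.
  by split=> //; rewrite lerD2l le_chain.
- have [s1 [s2 [p1 p2 h]]] := ih x xs (introT andP (conj (ltW ux) ul)).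
  exists (x :: s1), s2; rewrite /= -addrA lerD2l; split => //.
  by move: p1; rewrite /itv_partition/= ax.
- move: au; rewrite le_eqVlt => /predU1P[->|au].
    exists [::], (x :: s); rewrite /itv_partition/= xu xs add0r eqxx.
    by split => //; rewrite lerD// le_chain.
  exists [:: u], (x :: s); rewrite /itv_partition/= xu au xs eqxx addr0.
  by split => //; rewrite addrA lerD// le_chain.
Qed.

End chain.

(** * Arc length *)

(** Serves both for Lipschitz functions ([W] the identity) and for arc length
    ([W] a sum of total variations). *)
Lemma within_continuous_dominated {R : realType} (D : set R) (f W : R -> R) :
    {within D, continuous W} ->
    (forall u v, D u -> D v -> `|f u - f v| <= `|W u - W v|) ->
  {within D, continuous f}.
Proof.
move=> /subspace_continuousP WC fW; apply/subspace_continuousP => x Dx.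
apply/cvgrPdist_lt => e e0.
have := WC x Dx => /cvgrPdist_lt/(_ e e0).
rewrite !near_withinE; apply: filterS => y h Dy.
exact: le_lt_trans (fW _ _ Dx Dy) (h Dy).
Qed.

Section arc_length.
Context {R : realType} {n : nat}.
Variables (g : R -> 'rV[R]_n).
Implicit Types a b u v : R.

Local Notation coord i := (fun t => g t ord0 i).

Lemma polygonal_lengthE a b s :
  polygonal_length g a b s = chain (fun x y => norm2 (g y - g x)) a s.
Proof. exact: (chainE (fun x y => norm2 (g y - g x)) a b s). Qed.

Lemma variation_coordE a b i s :
  variation a b (coord i) s = chain (fun x y => `|(g y - g x) ord0 i|) a s.
Proof.
rewrite -(chainE _ _ b) /variation; apply: eq_bigr => k _.
by rewrite !mxE.
Qed.

Lemma curve_length_ge0 a b : a <= b -> (0 <= curve_length g a b)%E.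
Proof.
rewrite le_eqVlt => /predU1P[->|ab]; apply: ereal_sup_ge.
  exists 0%E => //; exists [::]; first by split.
  by rewrite polygonal_lengthE.
exists (polygonal_length g a b [:: b])%:E.
  by exists [:: b] => //; exact: itv_partition1.
by rewrite lee_fin sumr_ge0// => i _; exact: norm2_ge0.
Qed.

Lemma curve_lengthxx a : curve_length g a a = 0%E.
Proof.
apply/eqP; rewrite eq_le curve_length_ge0// andbT.
apply: ge_ereal_sup => _ [s /itv_partitionxx -> <-].
by rewrite polygonal_lengthE.
Qed.

(** A weak superadditivity of arc length: any subdivision of [[a, u]] extends by
    [v]. *)
Lemma curve_lengthD_chord a u v : a <= u -> u <= v ->
  (curve_length g a u + (norm2 (g v - g u))%:E <= curve_length g a v)%E.
Proof.
move=> au; rewrite le_eqVlt => /predU1P[<-|uv].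
  by rewrite subrr norm20 adde0.
rewrite -leeBrDr//; apply: ge_ereal_sup => _ [s [s1 /eqP s2] <-].
rewrite leeBrDr// -EFinD; apply: ereal_sup_ubound.
exists (rcons s v).
  by split; rewrite ?rcons_path ?last_rcons// s1 s2.
by rewrite !polygonal_lengthE chain_rcons s2.
Qed.

Lemma le_curve_length a u v : a <= u -> u <= v ->
  (curve_length g a u <= curve_length g a v)%E.
Proof.
move=> au uv; apply: le_trans (curve_lengthD_chord au uv).
by rewrite leeDl// lee_fin norm2_ge0.
Qed.

(** Arc length increases no more than the sum of the variations of the
    coordinates, from which it will inherit continuity. *)
Lemma curve_length_le_total_variation a u v : a <= u -> u <= v ->
  (curve_length g a v <=
   curve_length g a u + \sum_i total_variation u v (coord i))%E.
Proof.
move=> au uv; apply: ge_ereal_sup => _ [s [s1 /eqP s2] <-].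
have [||||t1 [t2 [p1 p2 h]]] := @chain_insert _ (fun x y => norm2 (g y - g x))
    (fun x y => \sum_i `|(g y - g x) ord0 i|) a s u _ _ _ s1.
- move=> x y z; have -> : g z - g x = (g y - g x) + (g z - g y) by rewrite [RHS]addrC subrKA.
  exact: norm2D_le_sum.
- by move=> x z; exact: norm2_le_sum.
- by move=> x; exact: norm2_ge0.
- by rewrite au s2.
move: h; rewrite polygonal_lengthE -lee_fin EFinD => /le_trans; apply.
rewrite leeD//.
  by apply: ereal_sup_ubound; exists t1 => //; rewrite polygonal_lengthE.
rewrite chain_sum -sumEFin; apply: lee_sum => i _.
apply: ereal_sup_ubound; exists (variation u v (coord i) t2).
  by apply: variations_variation; rewrite -s2.
by rewrite variation_coordE.
Qed.

Section rectifiable.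
Variables a b : R.
Hypotheses (ab : a < b) (gC : {within `[a, b], continuous g}).
Hypothesis (gfin : (curve_length g a b < +oo)%E).

Local Notation len u := (fine (curve_length g a u)).

Lemma curve_length_fin_num u : a <= u <= b -> curve_length g a u \is a fin_num.
Proof.
move=> /andP[au ub]; rewrite ge0_fin_numE ?curve_length_ge0//.
by rewrite (le_lt_trans (le_curve_length au ub)).
Qed.

Lemma chord_le_arc u v : a <= u -> u <= v -> v <= b ->
  norm2 (g v - g u) <= len v - len u.
Proof.
move=> au uv vb; rewrite lerBrDl -lee_fin EFinD !fineK ?curve_length_fin_num//.
- exact: curve_lengthD_chord.
- by rewrite vb (le_trans au).
- by rewrite au (le_trans uv).
Qed.

Lemma coord_bounded_variation i : bounded_variation a b (coord i).
Proof.
apply/bounded_variationP; first exact: ltW.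
rewrite ge0_fin_numE ?total_variation_ge0 ?(ltW ab)//.
apply: le_lt_trans gfin; apply: ge_ereal_sup => _ [_ [s sab <-] <-].
apply: ereal_sup_ge; exists (polygonal_length g a b s)%:E; first by exists s.
rewrite lee_fin variation_coordE polygonal_lengthE.
by apply: le_chain => x y; exact: coord_le_norm2.
Qed.

Lemma coord_within_continuous i : {within `[a, b], continuous (coord i)}.
Proof.
apply/subspace_continuousP => x xab.
apply: (@cvg_comp _ _ _ g (fun z : 'rV[R]_n => z ord0 i) _ (nbhs (g x))).
  by move/subspace_continuousP : gC; exact.
exact: coord_continuous.
Qed.

Lemma curve_length_continuous : {within `[a, b], continuous (fun u => len u)}.
Proof.
pose W u := \sum_i fine (total_variation a u (coord i)).
have WC : {within `[a, b], continuous W}.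
  have -> : W = \sum_i (fun u => fine (total_variation a u (coord i))).
    by apply/funext => u; rewrite fct_sumE.
  elim/big_ind: _ => [x|f h fC hC|i _]; first exact: cvg_cst.
    exact: within_continuousD.
  apply: total_variation_continuous => //.
    exact: coord_within_continuous.
  exact: coord_bounded_variation.
have TVfin i u : a <= u <= b -> total_variation a u (coord i) \is a fin_num.
  move=> /andP[au ub]; apply/bounded_variationP => //.
  by apply: bounded_variationl ub _ => //; exact: coord_bounded_variation.
have lenW u v : a <= u -> u <= v -> v <= b -> `|len u - len v| <= `|W u - W v|.
  move=> au uv vb.
  have ub := le_trans uv vb; have av := le_trans au uv.
  have luv : len u <= len v.
    by rewrite -subr_ge0 (le_trans (norm2_ge0 _) (chord_le_arc au uv vb)).
  rewrite distrC [leRHS]distrC ger0_norm ?subr_ge0// (le_trans _ (ler_norm _))//.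
  rewrite lerBlDl /W -sumrB -lee_fin EFinD !fineK ?curve_length_fin_num ?au ?av ?ub ?vb//.
  rewrite (le_trans (curve_length_le_total_variation au uv))// leeD2l//.
  rewrite -sumEFin; apply: lee_sum => i _.
  rewrite EFinB !fineK ?TVfin ?au ?av ?ub ?vb// (total_variationD _ au uv).
  by rewrite addeAC subee ?add0e// TVfin// au ub.
apply: (within_continuous_dominated WC) => u v /=; rewrite !in_itv/=.
move=> /andP[au ub] /andP[av vb].
have [uv|/ltW vu] := leP u v; first exact: lenW.
by rewrite distrC [leRHS]distrC lenW.
Qed.
End rectifiable.
End arc_length.

(** * Arc length parametrization *)

Section arc_length_parametrization.
Context {R : realType} {n : nat}.
Variables (g : R -> 'rV[R]_n) (a b : R).
Hypotheses (ab : a < b) (gC : {within `[a, b], continuous g}).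
Hypothesis (gfin : (curve_length g a b < +oo)%E).

Local Notation len u := (fine (curve_length g a u)).

(** The intermediate value theorem for arc length makes the choice in the
    definition of [arc_param] a choice in a nonempty set. *)
Lemma arc_paramP t : 0 <= t <= len b ->
  exists u, [/\ a <= u <= b, len u = t & arc_param g a b t = g u].
Proof.
move=> /andP[t0 tb].
have [u uab ut] : exists2 u, u \in `[a, b] & len u = t.
  apply: IVT (curve_length_continuous ab gC gfin) _; first exact: ltW.
  by rewrite curve_lengthxx/= ge_min le_max t0 tb orbT.
have /getPex[] : exists u, [set u | a <= u <= b /\ curve_length g a u = t%:E] u.
  exists u; split; first by rewrite in_itv in uab.
  by rewrite -ut fineK// (curve_length_fin_num gfin)//; rewrite in_itv in uab.
set w := get _ => wab wt; exists w; split => //.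
by rewrite wt.
Qed.

(** A function that is 1-Lipschitz for arc length along the curve pulls back to
    a 1-Lipschitz function of the arc length parameter. *)
Lemma arc_param_lipschitz (f : 'rV[R]_n -> R) :
    (forall u v, a <= u -> u <= v -> v <= b ->
       `|f (g v) - f (g u)| <= len v - len u) ->
  forall s t, 0 <= s <= len b -> 0 <= t <= len b ->
  `|f (arc_param g a b s) - f (arc_param g a b t)| <= `|s - t|.
Proof.
move=> fg s t /arc_paramP[u [/andP[au ub] <- ->]] /arc_paramP[v [/andP[av vb] <- ->]].
have [uv|/ltW vu] := leP u v; last exact: le_trans (fg _ _ av vu ub) (ler_norm _).
by rewrite distrC [leRHS]distrC (le_trans (fg _ _ au uv vb))// ler_norm.
Qed.

(** The parameters [0] and [len b] need not come from the end points [a] and [b]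
    themselves, but [f] cannot vary along a piece of the curve of length zero. *)
Lemma arc_param_ends (f : 'rV[R]_n -> R) :
    (forall u v, a <= u -> u <= v -> v <= b ->
       `|f (g v) - f (g u)| <= len v - len u) ->
  f (arc_param g a b 0) = f (g a) /\ f (arc_param g a b (len b)) = f (g b).
Proof.
move=> fg; have L0 : 0 <= len b by rewrite fine_ge0// curve_length_ge0// ltW.
split.
  have [|u [/andP[au ub] u0 ->]] := @arc_paramP 0; first by rewrite lexx.
  apply/eqP; rewrite -subr_eq0 -normr_le0 (le_trans (fg _ _ _ au ub))//.
  by rewrite u0 curve_lengthxx subrr.
have [|u [/andP[au ub] u0 ->]] := @arc_paramP (len b); first by rewrite L0 lexx.
apply/eqP; rewrite -subr_eq0 -normr_le0 distrC (le_trans (fg _ _ au ub _))//.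
by rewrite u0 subrr.
Qed.

End arc_length_parametrization.

(** * Lipschitz images and Lebesgue measure *)

Section lipschitz_image.
Context {R : realType}.
Implicit Types (T Y : set R) (h : R -> R).

(** A cover of [T] by intervals yields a cover of the image of [T] by intervals
    that are no longer. As the Lebesgue measure of [T] is defined as the infimum
    over such covers, [T] may be any set. *)
Lemma lipschitz_image_ge_measure h T Y (c d : R) :
    (forall s t, T s -> T t -> `|h s - h t| <= `|s - t|) ->
    countable Y -> c <= d -> `[c, d]%classic `<=` Y `|` h @` T ->
  ((d - c)%:E <= lebesgue_measure T)%E.
Proof.
move=> hT cY cd cdT.
rewrite [leRHS]/lebesgue_measure/= /lebesgue_stieltjes_measure/=.
rewrite /measure_extension/=.
apply: le_ereal_inf_tmp => _ [F [mF TF] <-].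
pose A k := h @` (T `&` F k).
(* the hull of the image of the part of [T] in the [k]-th interval *)
pose J k : set R := if pselect (A k !=set0) then `[inf (A k), sup (A k)]%classic else set0.
have mJ k : measurable (J k) by rewrite /J; case: pselect => /= _; [exact: measurable_itv|exact: measurable0].
have Fitv k : exists pq : R * R, F k = `]pq.1, pq.2]%classic.
  by have [pq _ <-] := mF k; exists pq.
have Abd k : A k !=set0 -> exists pq : R * R, [/\ F k = `]pq.1, pq.2]%classic,
    pq.1 < pq.2 & forall x y, A k x -> A k y -> x <= y + (pq.2 - pq.1)].
  move=> [_ [t0 [_ Ft0] _]]; have [pq Fpq] := Fitv k; exists pq; split => //.
    by move: Ft0; rewrite Fpq/= in_itv/= => /andP[p1 p2]; exact: lt_le_trans p1 p2.
  move=> _ _ [s [Ts Fs] <-] [t [Tt Ft] <-]; rewrite -lerBlDl.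
  rewrite (le_trans (ler_norm _))// (le_trans (hT _ _ Ts Tt))//.
  move: Fs Ft; rewrite Fpq/= !in_itv/= => /andP[s1 s2] /andP[t1 t2].
  by rewrite ler_norml; apply/andP; split; lra.
have AJ k : A k `<=` J k.
  move=> x Ax; rewrite /J; case: pselect => /= [A0|]; last by case; exists x.
  have [pq [_ _ Axy]] := Abd k A0.
  rewrite /= in_itv/=; apply/andP; split.
    apply: ge_inf => //; exists (x - (pq.2 - pq.1)) => y Ay.
    by rewrite lerBlDr; exact: Axy.
  apply: ub_le_sup => //; exists (x + (pq.2 - pq.1)) => y Ay.
  exact: Axy.
have JF k : (lebesgue_measure (J k) <= wlength idfun (F k))%E.
  rewrite /J; case: pselect => /= [A0|_]; last first.
    by rewrite measure0; have [pq ->] := Fitv k; exact: wlength_ge0.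
  have [pq [-> pqlt Axy]] := Abd k A0.
  have sA y : A k y -> sup (A k) <= y + (pq.2 - pq.1).
    by move=> Ay; apply: ge_sup => // x Ax; exact: Axy.
  have iA : sup (A k) - (pq.2 - pq.1) <= inf (A k).
    by apply: lb_le_inf => // y /sA; rewrite lerBlDr.
  rewrite lebesgue_measure_itv wlength_itv/= !lte_fin pqlt.
  case: ifPn => _; last by rewrite lee_fin subr_ge0 ltW.
  by rewrite -EFinB lee_fin; move: iA; lra.
have mY : measurable Y by apply: countable_measurable => // t; exact: measurable_set1.
have cdJ : `[c, d]%classic `<=` Y `|` \bigcup_k J k.
  move=> x /cdT[Yx|[t Tt <-]]; [by left|right].
  by have [k _ Fkt] := TF _ Tt; exists k => //; apply: AJ; exists t.
have mUJ : measurable (\bigcup_k J k) by exact: bigcup_measurable.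
have -> : (d - c)%:E = lebesgue_measure `[c, d]%classic.
  rewrite lebesgue_measure_itv/= lte_fin; case: ltgtP cd => // -> _.
  by rewrite subrr.
have : (lebesgue_measure `[c, d]%classic <= lebesgue_measure (Y `|` \bigcup_k J k))%E.
  by apply: le_measure; rewrite ?inE//; exact: measurableU.
move=> /le_trans; apply.
have := measureU2 (@lebesgue_measure R) mY mUJ => /le_trans; apply.
rewrite [X in (X + _)%E](countable_lebesgue_measure0 cY) add0e.
have := measure_sigma_subadditive (@lebesgue_measure R) mJ mUJ (@subset_refl _ _).
move=> /le_trans; apply.
by apply: lee_nneseries => [k _ _|k _]; [exact: measure_ge0|exact: JF].
Qed.

(** The measure of [T] controls the oscillation of [h] since [h] takes only
    countably many values off [T]. *)
Lemma lipschitz_oscillation_le_measure h T Y (L : R) : 0 <= L ->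
    (forall s t, 0 <= s <= L -> 0 <= t <= L -> `|h s - h t| <= `|s - t|) ->
    T `<=` `[0, L]%classic -> countable Y ->
    (forall t, 0 <= t <= L -> T t \/ Y (h t)) ->
  (`|h L - h 0|%:E <= lebesgue_measure T)%E.
Proof.
move=> L0 hL TL cY TY.
have hC : {within `[0, L]%classic, continuous h}.
  apply: (@within_continuous_dominated _ _ _ id).
    by apply: continuous_subspaceT => x; exact: cvg_id.
  by move=> u v; rewrite /= !in_itv/=; exact: hL.
have -> : `|h L - h 0| = Num.max (h 0) (h L) - Num.min (h 0) (h L).
  by have [h0L|/ltW hL0] := leP (h 0) (h L); [rewrite ger0_norm ?subr_ge0|
    rewrite distrC ger0_norm ?subr_ge0].
apply: (@lipschitz_image_ge_measure h T Y) => //.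
- move=> s t /TL + /TL; rewrite /= !in_itv/=; exact: hL.
- by rewrite ge_min !le_max !lexx.
- move=> y /=; rewrite in_itv/= => yh.
  have [t tL <-] := IVT L0 hC yh; rewrite in_itv/= in tL.
  by have [Tt|Yt] := TY t tL; [right; exists t|left].
Qed.

End lipschitz_image.

(** * Zeros of continuous functions *)

Section first_zero.
Context {R : realType}.
Implicit Types (m : R -> R) (u v w : R).

(** The infimum of the zeros, which is a zero by continuity. *)
Lemma first_zero m u v : u <= v -> {within `[u, v], continuous m} ->
    0 < m u -> m v <= 0 ->
  exists w, [/\ u <= w <= v, m w = 0 & forall t, u <= t < w -> 0 < m t].
Proof.
move=> uv mC mu mv.
pose Z := [set t | u <= t <= v /\ m t = 0].
have [w0 w0uv mw0] : exists2 w, w \in `[u, v] & m w = 0.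
  by apply: IVT => //; rewrite ge_min mv orbT le_max (ltW mu).
have Z0 : Z !=set0 by exists w0; rewrite in_itv in w0uv.
have Zu : lbound Z u by move=> t [/andP[]].
have uw : u <= inf Z by apply: lb_le_inf.
have wv : inf Z <= v.
  have [t [/andP[ut tv] mt]] := Z0; apply: (le_trans _ (tv)).
  apply: ge_inf; first by exists u.
  by split => //; rewrite ut.
have ltw t : u <= t < inf Z -> 0 < m t.
  move=> /andP[ut tw]; rewrite ltNge; apply/negP => mt.
  have tv : t <= v by exact: le_trans (ltW tw) wv.
  have [r rut mr] : exists2 r, r \in `[u, t] & m r = 0.
    apply: IVT => //; last by rewrite ge_min mt orbT le_max (ltW mu).
    by apply: continuous_subspaceW mC; apply: subset_itvl; rewrite bnd_simp.
  move: rut; rewrite in_itv/= => /andP[ur rt].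
  have : inf Z <= r.
    apply: ge_inf; first by exists u.
    by split => //; rewrite ur (le_trans rt).
  by rewrite leNgt (le_lt_trans rt tw).
exists (inf Z); split; rewrite ?uw//.
apply/eqP; rewrite eq_le; apply/andP; split; rewrite leNgt; apply/negP => mw.
  (* [m] stays positive near [inf Z], so no zero is close to [inf Z] *)
  have /subspace_continuousP/(_ (inf Z)) := mC.
  rewrite /= in_itv/= uw wv => /(_ isT)/cvgrPdist_lt/(_ _ mw).
  rewrite near_withinE => /nbhs_ballP[d /= d0 dw].
  have [t Zt tw] := @inf_adherent _ Z d d0 (conj Z0 (ex_intro _ u Zu)).
  have wt : inf Z <= t by apply: ge_inf => //; exists u.
  have [/andP[ut tv] mt] := Zt.
  have : ball (inf Z) d t by rewrite /ball/= ltr_norml; apply/andP; split; lra.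
  move=> /dw; rewrite /= in_itv/= ut tv => /(_ isT) mwt.
  have : `|m (inf Z) - m t| < m (inf Z) by exact: mwt.
  by rewrite mt subr0 gtr0_norm// ltxx.
have {uw}uw : u < inf Z.
  by rewrite lt_neqAle uw andbT; apply: contraTneq mu => ->; rewrite -leNgt ltW.
have [r rut mr] : exists2 r, r \in `[u, inf Z] & m r = 0.
  apply: IVT; first exact: ltW.
    by apply: continuous_subspaceW mC; apply: subset_itvl; rewrite bnd_simp.
  by rewrite ge_min (ltW mw) orbT le_max (ltW mu).
move: rut; rewrite in_itv/= => /andP[ur].
rewrite le_eqVlt => /predU1P[rw|rw]; first by move: mw; rewrite -rw mr ltxx.
by have := ltw r; rewrite ur rw mr ltxx => /(_ isT).
Qed.

Lemma last_zero m u v : u <= v -> {within `[u, v], continuous m} ->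
    m u <= 0 -> 0 < m v ->
  exists w, [/\ u <= w <= v, m w = 0 & forall t, w < t <= v -> 0 < m t].
Proof.
move=> uv mC mu mv.
have [||||w [wuv mw h]] := @first_zero (m \o -%R) (- v) (- u).
- by rewrite lerN2.
- by apply: within_continuous_compN; rewrite !opprK.
- by rewrite /= opprK.
- by rewrite /= opprK.
exists (- w); split => //.
  by rewrite lerNr lerNl andbC.
by move=> t wt; rewrite -(opprK t); apply: h; rewrite lerN2 ltrNl andbC.
Qed.

End first_zero.

(** * Wedge and core of a slit *)

Section one_slit.
Context {R : realType} {n : nat}.
Variables (e : R) (s : slit R n).
Local Notation V := 'rV[R]_n.+1.
Implicit Types z w : V.
Local Notation x0 := (slit_corner s ord0 ord0).
Local Notation c i := (slit_corner s ord0 i).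
Local Notation l := (slit_length s).

(** Distance (in the sup norm) to the lateral faces of the collar, truncated at
    its thickness [e * l] and negative outside the fiber of the slit. The default
    value of the minimum provides the truncation. *)
Definition depth (z : V) : R := \big[Num.min/ e * l]_(i < n.+1 | i != ord0)
  Num.min (z ord0 i - c i) (c i + l - z ord0 i).

Definition tent (z : V) : R := x0 + depth z.

Definition wedge : set V := [set z : V | x0 < z ord0 ord0 < tent z].

Definition core : set V := [set z : V | x0 < z ord0 ord0 < x0 + e * l /\
  forall i, i != ord0 -> c i + e * l <= z ord0 i <= c i + l - e * l].

Lemma depth_geP m z : m <= depth z <-> (m <= e * l /\
  forall i, i != ord0 -> m <= z ord0 i - c i /\ m <= c i + l - z ord0 i).
Proof.
split=> [/bigmin_geP[mel mi]|[mel mi]].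
  by split => // i /mi; rewrite le_min => /andP.
by apply/bigmin_geP; split => // i /mi; rewrite le_min => /andP.
Qed.

Lemma wedge_collar : wedge `<=` collar e s.
Proof.
move=> z /= /andP[xz zt]; have /depth_geP[zel zi] : z ord0 ord0 - x0 <= depth z.
  by rewrite lerBlDl ltW.
have el : depth z <= e * l by have /depth_geP[] := lexx (depth z).
have xz0 : 0 < z ord0 ord0 - x0 by rewrite subr_gt0.
split => /=; first by rewrite xz (lt_le_trans zt)// lerD2l.
by move=> i /zi[h1 h2]; apply/andP; split; lra.
Qed.

Lemma core_tent (z : V) : core z -> tent z = x0 + e * l.
Proof.
move=> [_ zi]; rewrite /tent; congr (_ + _); apply/eqP; rewrite eq_le.
apply/andP; split; first by have /depth_geP[] := lexx (depth z).
by apply/depth_geP; split => // i /zi/andP[h1 h2]; split; lra.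
Qed.

Lemma core_wedge : core `<=` wedge.
Proof. by move=> z zc; rewrite /wedge /= core_tent//; case: zc. Qed.

(** A minimum of functions that are 1-Lipschitz for the sup norm. *)
Lemma depth_lipschitz r (z w : V) : (forall i, `|z ord0 i - w ord0 i| <= r) ->
  `|depth z - depth w| <= r.
Proof.
have half (z' w' : V) : (forall i, `|z' ord0 i - w' ord0 i| <= r) -> depth z' - r <= depth w'.
  move=> zw; have [h1 h2] := (depth_geP (depth z') z').1 (lexx _).
  have r0 : 0 <= r by apply: le_trans (zw ord0).
  apply/depth_geP; split; first by lra.
  by move=> i /h2[h3 h4]; move: (zw i); rewrite ler_norml => /andP[h5 h6]; split; lra.
move=> zw; have h1 := half _ _ zw.
have h2 : depth w - r <= depth z by apply: half => i; rewrite distrC.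
by rewrite ler_norml; apply/andP; split; lra.
Qed.

Lemma tent_lipschitz (z w : V) : `|tent z - tent w| <= norm2 (z - w).
Proof.
rewrite /tent opprD addrACA subrr add0r; apply: depth_lipschitz => i.
by have := coord_le_norm2 (z - w) i; rewrite !mxE.
Qed.

Lemma tent_continuous : continuous tent.
Proof.
move=> z U /= /nbhs_ballP[r /= r0 rU]; apply/nbhs_ballP.
exists (r / 2) => [|w [_ zw]]; first exact: divr_gt0.
apply: rU; apply: le_lt_trans (_ : r / 2 < r); last by rewrite ltr_pdivrMr// ltr_pMr// ltr1n.
rewrite /tent opprD addrACA subrr add0r; apply: depth_lipschitz => i.
by have := zw ord0 i; rewrite /ball/= => /ltW.
Qed.

(** The hypothesis says that [z] is on the boundary of the wedge. There either
    [tent z] is the first coordinate already, or [z] is on the left side, at a point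
    of nonnegative depth: this point belongs to the slit. *)
Lemma tent_boundary (z : V) : ~ slit_set s z ->
  Num.min (z ord0 ord0 - x0) (tent z - z ord0 ord0) = 0 -> tent z = z ord0 ord0.
Proof.
move=> zs; have [h1 h2|h1 h2] := leP (z ord0 ord0 - x0); last first.
  by apply/eqP; rewrite -subr_eq0 h2.
have zx : z ord0 ord0 = x0 by apply/eqP; rewrite -subr_eq0 h2.
apply: contra_notP zs => tz; split => //= i i0.
have d0 : 0 <= depth z.
  by move: h1; rewrite h2 zx /tent addrAC subrr add0r.
have [_ /(_ i i0)[]] := (depth_geP 0 z).1 d0.
by move=> h3 h4; apply/andP; split; lra.
Qed.

End one_slit.

(** * The potential along a curve *)

Section wedge_crossing.
Context {R : realType} {n : nat}.
Variables (e : R) (s : slit R n) (g : R -> 'rV[R]_n.+1) (u v : R).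
Hypotheses (uv : u <= v) (gC : {within `[u, v], continuous g}).
Hypothesis gs : forall t, u <= t <= v -> ~ slit_set s (g t).

(* positive exactly in the wedge *)
Let gap (z : 'rV[R]_n.+1) : R :=
  Num.min (z ord0 ord0 - slit_corner s ord0 ord0) (tent e s z - z ord0 ord0).

Let gapP z : wedge e s z <-> 0 < gap z.
Proof. by rewrite /gap lt_min !subr_gt0. Qed.

Let gapC : {within `[u, v], continuous (gap \o g)}.
Proof.
have hC : continuous (fun z : 'rV[R]_n.+1 => z ord0 ord0) by exact: coord_continuous.
apply: within_continuous_comp gC => z _.
apply: (@continuous_min R _
  (fun z : 'rV[R]_n.+1 => z ord0 ord0 - slit_corner s ord0 ord0)
  (fun z => tent e s z - z ord0 ord0)).
  by apply: continuousB; [exact: hC|exact: cst_continuous].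
by apply: continuousB; [exact: tent_continuous|exact: hC].
Qed.

(** Since the slit blocks the left side of the wedge, the curve crosses its boundary
    only where the tent function is the first coordinate. *)
Lemma wedge_exit : wedge e s (g u) -> ~ wedge e s (g v) ->
  exists w, [/\ u <= w <= v, tent e s (g w) = g w ord0 ord0 &
    forall t, u <= t < w -> wedge e s (g t)].
Proof.
move=> /gapP gu /gapP/negP; rewrite -leNgt => gv.
have [w [wuv gw h]] := first_zero uv gapC gu gv.
exists w; split => //; last by move=> t /h/gapP.
exact: tent_boundary (gs wuv) gw.
Qed.

Lemma wedge_entrance : ~ wedge e s (g u) -> wedge e s (g v) ->
  exists w, [/\ u <= w <= v, tent e s (g w) = g w ord0 ord0 &
    forall t, w < t <= v -> wedge e s (g t)].
Proof.
move=> /gapP/negP; rewrite -leNgt => gu /gapP gv.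
have [w [wuv gw h]] := last_zero uv gapC gu gv.
exists w; split => //; last by move=> t /h/gapP.
exact: tent_boundary (gs wuv) gw.
Qed.

End wedge_crossing.

Section potential.
Context {R : realType} {n : nat}.
Local Notation V := 'rV[R]_n.+1.
Variables (e : R) (S : nat -> slit R n).
Hypothesis disjS : forall l m, l != m ->
  collar e (S l) `&` collar e (S m) = set0.

(** The collars being disjoint, at most one wedge contains a given point, and the
    choice of the index is immaterial. *)
Definition potential (z : V) : R :=
  if pselect (exists j, wedge e (S j) z) is left h
  then tent e (S (projT1 (cid h))) z else z ord0 ord0.

Lemma wedge_inj j k z : wedge e (S j) z -> wedge e (S k) z -> j = k.
Proof.
move=> /wedge_collar zj /wedge_collar zk; apply/eqP/negPn/negP => jk.
by have := disjS jk => /seteqP[/(_ z) + _]; apply.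
Qed.

Lemma potential_wedge j z : wedge e (S j) z -> potential z = tent e (S j) z.
Proof.
move=> zj; rewrite /potential; case: pselect => [h|]; last by case; exists j.
by case: cid => /= k /wedge_inj/(_ zj) ->.
Qed.

Lemma potential_out z : ~ (exists j, wedge e (S j) z) -> potential z = z ord0 ord0.
Proof. by rewrite /potential; case: pselect. Qed.

Section along_curve.
Variables (g : R -> V) (ell : R -> R) (a b : R).
Hypothesis gC : {within `[a, b], continuous g}.
Hypothesis gS : forall t j, a <= t <= b -> ~ slit_set (S j) (g t).
Hypothesis gell : forall u v, a <= u -> u <= v -> v <= b ->
  norm2 (g v - g u) <= ell v - ell u.

Let height_le u v : a <= u -> u <= v -> v <= b ->
  `|g v ord0 ord0 - g u ord0 ord0| <= ell v - ell u.
Proof.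
move=> au uv vb; apply: le_trans (gell au uv vb).
by have := coord_le_norm2 (g v - g u) ord0; rewrite !mxE.
Qed.

Let tent_le j u v : a <= u -> u <= v -> v <= b ->
  `|tent e (S j) (g v) - tent e (S j) (g u)| <= ell v - ell u.
Proof. by move=> au uv vb; apply: le_trans (gell au uv vb); exact: tent_lipschitz. Qed.

Let sub_gC u v : a <= u -> v <= b -> {within `[u, v], continuous g}.
Proof.
by move=> au vb; apply: continuous_subspaceW gC => t /=; rewrite !in_itv/= =>
  /andP[ut tv]; rewrite (le_trans au ut) (le_trans tv vb).
Qed.

Let sub_gS u v j : a <= u -> v <= b ->
  forall t, u <= t <= v -> ~ slit_set (S j) (g t).
Proof.
by move=> au vb t /andP[ut tv]; apply: gS; rewrite (le_trans au ut) (le_trans tv vb).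
Qed.

Let same_wedge z w := exists j, wedge e (S j) z /\ wedge e (S j) w.

(* [w = u] when [g u] lies in no wedge *)
Let exit u v : a <= u -> u <= v -> v <= b -> ~ same_wedge (g u) (g v) ->
  exists w, [/\ u <= w <= v, `|potential (g u) - g w ord0 ord0| <= ell w - ell u &
    forall t, u <= t < w -> same_wedge (g u) (g t)].
Proof.
move=> au uv vb uvN; have [[j uj]|uN] := pselect (exists j, wedge e (S j) (g u)).
  have vj : ~ wedge e (S j) (g v) by move=> vj; apply: uvN; exists j.
  have [w [/andP[uw wv] tw h]] :=
    wedge_exit uv (sub_gC au vb) (sub_gS (j := j) au vb) uj vj.
  exists w; split; first by rewrite uw.
    by rewrite (potential_wedge uj) -tw distrC tent_le// (le_trans wv).
  by move=> t /h tj; exists j.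
exists u; split; first by rewrite lexx.
  by rewrite potential_out// !subrr normr0.
by move=> t /andP[/le_lt_trans/[apply]]; rewrite ltxx.
Qed.

Let entrance u v : a <= u -> u <= v -> v <= b -> ~ same_wedge (g u) (g v) ->
  exists w, [/\ u <= w <= v, `|potential (g v) - g w ord0 ord0| <= ell v - ell w &
    forall t, w < t <= v -> same_wedge (g t) (g v)].
Proof.
move=> au uv vb uvN; have [[j vj]|vN] := pselect (exists j, wedge e (S j) (g v)).
  have uj : ~ wedge e (S j) (g u) by move=> uj; apply: uvN; exists j.
  have [w [/andP[uw wv] tw h]] :=
    wedge_entrance uv (sub_gC au vb) (sub_gS (j := j) au vb) uj vj.
  exists w; split; first by rewrite uw.
    by rewrite (potential_wedge vj) -tw tent_le// (le_trans au).
  by move=> t /h tj; exists j.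
exists v; split; first by rewrite lexx andbT.
  by rewrite potential_out// !subrr normr0.
by move=> t /andP[/lt_le_trans/[apply]]; rewrite ltxx.
Qed.

(** Let [w] be the time of exit from the wedge of [g u], and [w'] the time of the
    last entrance in the wedge of [g v]. These wedges being disjoint, [w <= w'].
    Between [u] and [w], and between [w'] and [v], one tent function controls the
    potential; between [w] and [w'] the first coordinate does. *)
Lemma potential_lipschitz u v : a <= u -> u <= v -> v <= b ->
  `|potential (g v) - potential (g u)| <= ell v - ell u.
Proof.
move=> au uv vb; have [[j [uj vj]]|uvN] := pselect (same_wedge (g u) (g v)).
  by rewrite (potential_wedge uj) (potential_wedge vj); exact: tent_le.
have [w [/andP[uw wv] Fu hw]] := exit au uv vb uvN.
have [w' [/andP[uw' wv'] Fv hw']] := entrance au uv vb uvN.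
have ww' : w <= w'.
  rewrite leNgt; apply/negP => w'w; apply: uvN.
  have /hw[j [uj tj]] : u <= (w' + w) / 2 < w by apply/andP; split; lra.
  have /hw'[k [tk vk]] : w' < (w' + w) / 2 <= v by apply/andP; split; lra.
  by exists j; rewrite {2}(wedge_inj tj tk).
have := height_le (le_trans au uw) ww' (le_trans wv' vb).
move: Fu Fv; rewrite !ler_norml => /andP[? ?] /andP[? ?] /andP[? ?].
by apply/andP; split; lra.
Qed.

End along_curve.
End potential.

(** * Volume of boxes and collars *)

Section boxes.
Context {R : realType} {n : nat}.
Implicit Types (K : 'I_n -> set (measurableTypeR R)) (B : set (measurableTypeR R)).
Local Notation mu := (@lebesgue_rV R n).

Lemma measurable_coord (i : 'I_n) :
  measurable_fun setT (fun z : borel_rV R n => (z : 'rV[R]_n) ord0 i : measurableTypeR R).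
Proof.
apply: (measurability _ (RGenOpens.measurableE R)).
move=> _ [_ [a [b ->] <-]].
rewrite setTI; apply: sub_sigma_algebra => /=.
have : continuous (fun z : 'rV[R]_n => z ord0 i) by exact: coord_continuous.
by move/continuousP; apply; exact: interval_open.
Qed.

Definition box K : set (borel_rV R n) := [set z : 'rV[R]_n | forall i, K i (z ord0 i)].

Lemma measurable_box K : (forall i, measurable (K i)) -> measurable (box K).
Proof.
move=> mK; rewrite (_ : box K = \bigcap_(i in [set: 'I_n])
    ((fun z : borel_rV R n => (z : 'rV[R]_n) ord0 i : measurableTypeR R) @^-1` K i)).
  apply: fin_bigcap_measurable => [|i _]; first exact: finite_finset.
  by rewrite -[X in measurable X]setTI; exact: measurable_coord.
by apply/seteqP; split => z /= h i; [move=> _|]; exact: h.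
Qed.

(** Replacing one side of a box; the margins of a collar are made of boxes that
    differ from the collar in one side only. *)
Definition upd K i B : 'I_n -> set (measurableTypeR R) :=
  fun j => if j == i then B else K j.

Lemma measurable_upd K i B : (forall i, measurable (K i)) -> measurable B ->
  forall j, measurable (upd K i B j).
Proof. by move=> mK mB j; rewrite /upd; case: ifP. Qed.

Lemma lebesgue_box_upd K i B (r : R) : (forall i, measurable (K i)) -> measurable B ->
    lebesgue_measure B = (r%:E * lebesgue_measure (K i))%E ->
  mu (box (upd K i B)) = (r%:E * mu (box K))%E.
Proof.
move=> mK mB BK; rewrite !lebesgue_rV_prod//; last exact: measurable_upd.
rewrite (bigD1 i)//= [in RHS](bigD1 i)//= {1}/upd eqxx BK muleA; congr (_ * _)%E.
by apply: eq_bigr => j /negbTE ji; rewrite /upd ji.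
Qed.

End boxes.

Lemma measure_bigsetU_le d (T : measurableType d) (R : realType)
    (mu : {measure set T -> \bar R}) (I : finType) (B : I -> set T) :
    (forall i, measurable (B i)) ->
  (mu (\big[setU/set0]_i B i) <= \sum_i mu (B i))%E.
Proof.
move=> mB; suff [] : measurable (\big[setU/set0]_i B i) /\
  (mu (\big[setU/set0]_i B i) <= \sum_i mu (B i))%E by [].
elim/big_rec2: _ => [|i r U _ [mU Ur]]; first by rewrite measure0.
split; first exact: measurableU.
by have := measureU2 mu (mB i) mU => /le_trans; apply; exact: leeD.
Qed.

Section collar_volume.
Context {R : realType} {n : nat}.
Local Notation V := 'rV[R]_n.+1.
Local Notation mu := (@lebesgue_rV R n.+1).
Variables (a b : V) (e : R).
Hypothesis e0 : 0 < e.

Lemma open_boxE : open_box a b = box (fun i => `]a ord0 i, b ord0 i[%classic).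
Proof. by apply/seteqP; split => z /= h i; have := h i; rewrite /= in_itv. Qed.

Lemma measurable_open_box : measurable (open_box a b : set (borel_rV R n.+1)).
Proof. by rewrite open_boxE; apply: measurable_box => i; exact: measurable_itv. Qed.

Section one_collar.
Variable s : slit R n.
Local Notation x0 := (slit_corner s ord0 ord0).
Local Notation c i := (slit_corner s ord0 i).
Local Notation l := (slit_length s).

Lemma coreE : core e s = box (fun i => if i == ord0 then `]x0, x0 + e * l[%classic
  else `[c i + e * l, c i + l - e * l]%classic).
Proof.
apply/seteqP; split => z /=.
  move=> [h0 h] i; case: (eqVneq i ord0) => [->|i0]; first by rewrite /= in_itv.
  by rewrite /= in_itv/=; exact: h.
move=> h; split; first by have := h ord0; rewrite eqxx /= in_itv.
by move=> i i0; have := h i; rewrite (negbTE i0) /= in_itv.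
Qed.

Lemma measurable_core : measurable (core e s : set (borel_rV R n.+1)).
Proof.
by rewrite coreE; apply: measurable_box => i; case: ifP => _; exact: measurable_itv.
Qed.

Let K (i : 'I_n.+1) : set (measurableTypeR R) :=
  if i == ord0 then `]x0, x0 + e * l[%classic `&` `]a ord0 ord0, b ord0 ord0[%classic
  else `[c i, c i + l]%classic.

Let mK i : measurable (K i).
Proof.
rewrite /K; case: ifP => _; last exact: measurable_itv.
by apply: measurableI; exact: measurable_itv.
Qed.

Hypothesis sI : slit_set s `<=` open_box a b.

(* so that only the first side of the collar has to be intersected with the box *)
Let slit_fits i : i != ord0 -> a ord0 i < c i /\ c i + l < b ord0 i.
Proof.
have l0 := slit_length_gt0 s.
move=> i0; have /sI/(_ i)/andP[h1 _] : slit_set s (slit_corner s).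
  by split => // j _; rewrite lexx lerDl ltW.
have /sI/(_ i) : slit_set s
    (\row_j (if j == ord0 then x0 else c j + l)).
  split => /=; first by rewrite mxE eqxx.
  by move=> j j0; rewrite mxE (negbTE j0) lexx lerDl ltW.
by rewrite mxE (negbTE i0) => /andP[].
Qed.

Let collarE : collar e s `&` open_box a b = box K.
Proof.
apply/seteqP; split => z /=.
  move=> [[h0 h] hI] i; rewrite /K; case: (eqVneq i ord0) => [->|i0].
    by split; rewrite /= in_itv/=.
  by rewrite /= in_itv/=; exact: h.
move=> h; split.
  split; first by have := h ord0; rewrite /K eqxx /= in_itv => -[].
  by move=> i i0; have := h i; rewrite /K (negbTE i0) /= in_itv.
move=> i; have := h i; rewrite /K; case: (eqVneq i ord0) => [->|i0].
  by move=> [_]; rewrite /= in_itv.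
rewrite /= in_itv/= => /andP[h1 h2]; have [h3 h4] := slit_fits i0.
by rewrite (lt_le_trans h3 h1) (le_lt_trans h2 h4).
Qed.

Lemma measurable_collar :
  measurable (collar e s `&` open_box a b : set (borel_rV R n.+1)).
Proof. by rewrite collarE; exact: measurable_box. Qed.

Let side (ib : 'I_n * bool) : set (borel_rV R n.+1) :=
  let i := lift ord0 ib.1 in
  box (upd K i (if ib.2 then `[c i, c i + e * l]%classic
                else `[c i + l - e * l, c i + l]%classic)).

Let mside ib : measurable (side ib).
Proof.
apply: measurable_box; apply: measurable_upd => //.
by case: ifP => _; exact: measurable_itv.
Qed.

Let mu_side ib : mu (side ib) = (e%:E * mu (collar e s `&` open_box a b))%E.
Proof.
have l0 := slit_length_gt0 s; have el0 := mulr_gt0 e0 l0.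
rewrite collarE /side; apply: lebesgue_box_upd => //.
  by case: ifP => _; exact: measurable_itv.
have -> : K (lift ord0 ib.1) = `[c (lift ord0 ib.1), c (lift ord0 ib.1) + l]%classic.
  by rewrite /K.
case: ib.2; rewrite !lebesgue_measure_itv/= !lte_fin -!EFinD.
  rewrite !ltrDl l0 el0 -EFinM; congr (_%:E); ring.
by rewrite ifT ?ltrDl ?l0 -?EFinM; [congr (_%:E); ring|lra].
Qed.

(** A point of the collar outside the core is at distance less than [e l] from one
    of the [2 n] lateral faces, hence in one of [2 n] slabs. Each of them has the
    sides of the collar, except for one which has length [e l] instead of [l]. *)
Lemma collar_margin_volume :
  (mu ((collar e s `&` open_box a b) `\` core e s) <=
   (n.*2%:R * e)%:E * mu (collar e s `&` open_box a b))%E.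
Proof.
have sub : (collar e s `&` open_box a b) `\` core e s `<=` \big[setU/set0]_ib side ib.
  rewrite collarE coreE => z [Kz /existsNP[i]].
  case: (eqVneq i ord0) => [->|i0].
    by have := Kz ord0; rewrite {1}/K eqxx => -[].
  have [j ij] : exists j, i = lift ord0 j.
    by case: (unliftP ord0 i) i0 => [j -> _|->]; [exists j|rewrite eqxx].
  have := Kz i; rewrite {1}/K (negbTE i0) /= !in_itv/= => /andP[h1 h2] /negP.
  rewrite negb_and -!ltNge => h.
  have [B zB] : exists B : bool, (if B then `[c i, c i + e * l]%classic
      else `[c i + l - e * l, c i + l]%classic) (z ord0 i).
    by case/orP: h => [/ltW h|/ltW h]; [exists true|exists false];
      rewrite /= in_itv/= ?h1 ?h2 ?h.
  rewrite (bigD1 (j, B))//=; left => k; rewrite /upd -ij.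
  by case: eqP => [->|_]; [exact: zB|exact: Kz].
have mU : measurable (\big[setU/set0]_ib side ib) by exact: bigsetU_measurable.
have : (mu ((collar e s `&` open_box a b) `\` core e s) <=
        mu (\big[setU/set0]_ib side ib))%E.
  apply: le_measure; rewrite ?inE//.
  by apply: measurableD; [exact: measurable_collar|exact: measurable_core].
move=> /le_trans; apply; apply: le_trans (measure_bigsetU_le mu mside) _.
rewrite (eq_bigr (fun=> (e%:E * mu (collar e s `&` open_box a b))%E)); last first.
  by move=> ib _; exact: mu_side.
rewrite sumr_const card_prod card_ord card_bool muln2 EFinM -muleA.
elim: n.*2 => [|k ih]; first by rewrite mulr0n mul0e.
by rewrite mulrS -nat1r EFinD ge0_muleDl ?lee_fin// mul1e; exact: leeD2l.
Qed.

End one_collar.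

Variable S : nat -> slit R n.
Hypothesis SI : forall m, slit_set (S m) `<=` open_box a b.
Hypothesis disjS : forall l m, l != m ->
  collar e (S l) `&` collar e (S m) = set0.

Lemma measurable_box_cores :
  measurable (open_box a b `\` \bigcup_m core e (S m) : set (borel_rV R n.+1)).
Proof.
apply: measurableD; first exact: measurable_open_box.
by apply: bigcup_measurable => m _; exact: measurable_core.
Qed.

(** Outside the cores there are the complement of the collars and the margins. The
    latter are controlled by the volumes of the collars, whose sum is at most the
    volume of the box. *)
Lemma box_cores_volume :
  (mu (open_box a b `\` \bigcup_m core e (S m)) <=
   mu (open_box a b `\` \bigcup_m collar e (S m)) +
   (n.*2%:R)%:E * mu (open_box a b) * e%:E)%E.
Proof.
pose C m := collar e (S m) `&` open_box a b.
have mC m : measurable (C m : set (borel_rV R n.+1)) by exact: measurable_collar.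
have mcore m : measurable (core e (S m) : set (borel_rV R n.+1)) by exact: measurable_core.
have mUC : measurable (\bigcup_m C m : set (borel_rV R n.+1)) by exact: bigcup_measurable.
have mI := measurable_open_box.
have mRest : measurable (open_box a b `\` \bigcup_m collar e (S m) : set (borel_rV R n.+1)).
  rewrite (_ : _ `\` _ = open_box a b `\` \bigcup_m C m); first exact: measurableD.
  apply/seteqP; split => z [zI h]; split=> // -[m _ zm]; apply: h.
    by case: zm => ? _; exists m.
  by exists m.
have mM m : measurable (C m `\` core e (S m) : set (borel_rV R n.+1)) by exact: measurableD.
have mUM : measurable (\bigcup_m (C m `\` core e (S m)) : set (borel_rV R n.+1)).
  exact: bigcup_measurable.
have sub : open_box a b `\` \bigcup_m core e (S m) `<=`
    (open_box a b `\` \bigcup_m collar e (S m)) `|` \bigcup_m (C m `\` core e (S m)).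
  move=> z [zI zc]; have [[m _ zm]|zN] := pselect ((\bigcup_m collar e (S m)) z).
    by right; exists m => //; split => // zm'; apply: zc; exists m.
  by left.
have : (mu (open_box a b `\` \bigcup_m core e (S m)) <=
    mu ((open_box a b `\` \bigcup_m collar e (S m)) `|`
        \bigcup_m (C m `\` core e (S m))))%E.
  by apply: le_measure; rewrite ?inE//; [exact: measurable_box_cores|exact: measurableU].
move=> /le_trans; apply.
have := measureU2 mu mRest mUM => /le_trans; apply; apply: leeD => //.
have := measure_sigma_subadditive mu mM mUM (@subset_refl _ _) => /le_trans; apply.
have tC : trivIset setT C.
  apply/trivIsetP => i j _ _ ij; apply/seteqP; split => // z [[zi _] [zj _]].
  by have /seteqP[/(_ z) + _] := disjS ij; apply.
apply: (@le_trans _ _ (\sum_(0 <= m <oo) ((n.*2%:R * e)%:E * mu (C m)))%E).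
  by apply: lee_nneseries => [m _ _|m _]; [exact: measure_ge0|exact: collar_margin_volume].
rewrite nneseriesZl => [|m _]; last exact: measure_ge0.
rewrite -(measure_semi_bigcup mu mC tC mUC).
rewrite muleAC -EFinM lee_wpmul2l//; first by rewrite lee_fin mulr_ge0// ltW.
apply: le_measure; rewrite ?inE//.
by move=> z [m _ []].
Qed.

End collar_volume.

(** * Slits near the left face *)

Section slits_near_the_left_face.
Context {R : realType} {n : nat}.

(** A side of the slit has length [l]; the slit must have at least one side, whence
    the condition on [n]. *)
Lemma slit_length_le_diam (s : slit R n) : (0 < n)%N ->
  slit_length s <= diam2 (slit_set s).
Proof.
move=> n0; have l0 := slit_length_gt0 s.
pose w : 'rV[R]_n.+1 := \row_j
  (slit_corner s ord0 j + (if j == ord0 then 0 else slit_length s)).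
have sc : slit_set s (slit_corner s).
  by split => // j _; rewrite lexx lerDl ltW.
have sw : slit_set s w.
  split; first by rewrite /= mxE eqxx addr0.
  by move=> j j0; rewrite mxE (negbTE j0) lexx lerDl ltW.
apply: le_trans (_ : norm2 (w - slit_corner s) <= _).
  have := coord_le_norm2 (w - slit_corner s) (lift ord0 (Ordinal n0)).
  by rewrite !mxE/= addrAC subrr add0r gtr0_norm.
apply: ub_le_sup; last by exists (w, slit_corner s).
exists (\sum_(i < n.+1) slit_length s) => _ [[y z] [[/= y0 ys] [/= z0 zs]] <-] /=.
apply: le_trans (norm2_le_sum _) _; apply: ler_sum => i _; rewrite !mxE.
case: (eqVneq i ord0) => [->|i0]; first by rewrite y0 z0 subrr normr0 ltW.
move: (ys i i0) (zs i i0) => /andP[h1 h2] /andP[h3 h4].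
by rewrite ler_norml; apply/andP; split; lra.
Qed.

(** All but finitely many slits are small, and the others are at a positive
    distance from the face. *)
Lemma slits_near_face_small (a : 'rV[R]_n.+1) (S : nat -> slit R n) (eta : R) :
    (0 < n)%N -> (forall m, a ord0 ord0 < slit_corner (S m) ord0 ord0) ->
    diam2 (slit_set (S i)) @[i --> \oo] --> (0 : R) -> 0 < eta ->
  exists2 d, 0 < d & forall m,
    slit_corner (S m) ord0 ord0 < a ord0 ord0 + d -> slit_length (S m) < eta.
Proof.
move=> n0 aS S0 eta0.
have /cvgrPdist_lt/(_ _ eta0)[N _ NS] := S0.
have [d d0 dS] : exists2 d, 0 < d & forall m, (m < N)%N ->
    a ord0 ord0 + d <= slit_corner (S m) ord0 ord0.
  elim: N {NS} => [|N [d d0 dS]]; first by exists 1.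
  exists (Num.min d (slit_corner (S N) ord0 ord0 - a ord0 ord0)).
    by rewrite lt_min d0 subr_gt0 aS.
  move=> m; rewrite ltnS leq_eqVlt -lerBrDl ge_min.
  by case/predU1P => [->|/dS]; [rewrite lexx orbT|rewrite lerBrDl => ->].
exists d => // m mS; have Nm : (N <= m)%N.
  by rewrite leqNgt; apply: contraTN mS => /dS; rewrite -leNgt.
have := NS m Nm; rewrite /= sub0r normrN => /(le_lt_trans (ler_norm _)).
by apply: le_lt_trans; exact: slit_length_le_diam.
Qed.

End slits_near_the_left_face.

(** * Curves joining the two faces *)

Section curves.
Context {R : realType} {n : nat}.
Local Notation V := 'rV[R]_n.+1.

(** The first coordinate maps the connected set formed by the faces and the closure
    of the curve to an interval, which contains its values on the two faces. *)
Lemma connects_heights (a b : V) (X : set V) g (c eta : R) :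
    (forall i, a ord0 i < b ord0 i) ->
    connects X (left_face a b) (right_face a b) g ->
    a ord0 ord0 < c < b ord0 ord0 -> 0 < eta ->
  exists2 t, 0 < t < 1 & `|c - g t ord0 ord0| < eta.
Proof.
move=> ab gconn /andP[ac cb] eta0.
pose pr (z : V) := z ord0 ord0.
have prC : continuous pr by exact: coord_continuous.
have /connected_intervalP prI : connected (pr @`
    (left_face a b `|` right_face a b `|` (closure (curve_image g) `&` X))).
  by apply: connected_continuous_connected => //; exact: continuous_subspaceT.
pose face (r : R) : V := \row_i (if i == ord0 then r else (a ord0 i + b ord0 i) / 2).
have faceP r i : i != ord0 -> a ord0 i < face r ord0 i < b ord0 i.
  by move=> i0; rewrite mxE (negbTE i0); have := ab i; lra.
have [|||z [[[z0 _]|[z0 _]]|[zg _]] zc] := prI (a ord0 ord0) (b ord0 ord0) _ _ c.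
- by exists (face (a ord0 ord0)); rewrite /pr ?mxE ?eqxx//; left; left; split;
    [rewrite mxE eqxx|exact: faceP].
- by exists (face (b ord0 ord0)); rewrite /pr ?mxE ?eqxx//; left; right; split;
    [rewrite mxE eqxx|exact: faceP].
- by rewrite !ltW.
- by move: ac; rewrite -zc /pr z0 ltxx.
- by move: cb; rewrite -zc /pr z0 ltxx.
have [_ [[t + <-] gt]] : curve_image g `&` [set w | `|c - pr w| < eta] !=set0.
  apply: zg; have /cvgrPdist_lt/(_ _ eta0) : pr @ z --> c by rewrite -zc; exact: prC.
  exact.
by rewrite /= in_itv/= => t01; exists t.
Qed.

Lemma arc_param_measurable (g : R -> V) (a b : R) :
    a < b -> {within `[a, b], continuous g} ->
    (curve_length g a b < +oo)%E ->
  measurable_fun `[0, fine (curve_length g a b)]%classic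
    (arc_param g a b : measurableTypeR R -> borel_rV R n.+1).
Proof.
move=> ab gC gfin; set D := `[0, _]%classic.
have arcC : {within D, continuous (arc_param g a b)}.
  apply/subspace_continuousP => t Dt U /nbhs_ballP[r /= r0 rU].
  change (nbhs t [set s | D s -> U (arc_param g a b s)]).
  apply/nbhs_ballP; exists r => // s ts Ds; apply: rU; split => // i j.
  rewrite ord1 /ball/=; apply: le_lt_trans ts.
  rewrite /D /= !in_itv/= in Dt Ds.
  apply: (arc_param_lipschitz ab gC gfin (f := fun z : V => z ord0 j)) => //.
  move=> u v au uv vb; apply: le_trans (chord_le_arc gfin au uv vb).
  by have := coord_le_norm2 (g v - g u) j; rewrite !mxE.
apply: (@measurability _ _ _ (borel_rV R n.+1) D _ [set U : set V | open U]) => //.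
move=> _ [U /= oU <-]; apply: open_measurable_subspace.
  exact: measurable_itv.
by move/continuousP : arcC; apply.
Qed.

End curves.

(** * The density and its line integrals *)

Section modulus_bound.
Context {R : realType} {n : nat}.
Local Notation V := 'rV[R]_n.+1.
Local Notation mu := (@lebesgue_rV R n.+1).

Definition density (W : R) (A : set V) (z : V) : R := W^-1 * \1_A z.

Lemma modulus_le_volume (W p : R) (A : set V) (G : set (R -> V)) :
    0 < W -> 1 <= p -> measurable (A : set (borel_rV R n.+1)) ->
    admissible G (density W A) ->
  (modulus p G <= (W `^ (- p))%:E * mu A)%E.
Proof.
move=> W0 p1 mA adm; apply: ereal_inf_lbound.
exists (density W A) => //.
have p0 : p != 0 by rewrite gt_eqF// (lt_le_trans ltr01).
transitivity (\int[mu]_x ((W `^ (- p))%:E * (\1_A (x : borel_rV R n.+1))%:E))%E.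
  apply: eq_integral => x _; rewrite -EFinM; congr (_%:E).
  rewrite /density powRM ?invr_ge0 ?(ltW W0)//.
  rewrite -(powR_inv1 (ltW W0)) -powRrM mulN1r indicE.
  by case: (x \in _); rewrite ?powR1// powR0.
rewrite ge0_integralZl_EFin//.
- by rewrite integral_indic// setIT.
- by apply/measurable_EFinP; exact: measurable_indic.
- exact: powR_ge0.
Qed.

Section segment.
Variables (e : R) (a b : V) (S : nat -> slit R n) (g : R -> V) (t0 t1 : R).
Hypothesis disjS : forall l m, l != m ->
  collar e (S l) `&` collar e (S m) = set0.
Hypothesis ab : a ord0 ord0 < b ord0 ord0.
Hypotheses (t01 : t0 < t1) (gC : {within `[t0, t1], continuous g}).
Hypothesis gfin : (curve_length g t0 t1 < +oo)%E.
Hypothesis gI : forall t, t0 <= t <= t1 -> open_box a b (g t).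
Hypothesis gS : forall t j, t0 <= t <= t1 -> ~ slit_set (S j) (g t).

Local Notation A := (open_box a b `\` \bigcup_m core e (S m)).
Local Notation W := (b ord0 ord0 - a ord0 ord0).

(** The potential is constant on each core, so along the curve it takes countably
    many values there. What remains of its oscillation is bounded by the length
    that the curve spends outside the cores. *)
Lemma potential_gap_le_integral :
  ((W^-1 * `|potential e S (g t1) - potential e S (g t0)|)%:E <=
   line_integral_seg (density W A) g t0 t1)%E.
Proof.
rewrite /line_integral_seg; set L := fine _; set arc := arc_param g t0 t1.
pose T := `[0, L]%classic `&` arc @^-1` A.
have W0 : 0 <= W^-1 by rewrite invr_ge0 subr_ge0 ltW.
have mL : measurable (`[0, L]%classic : set (measurableTypeR R)) by exact: measurable_itv.
have mT : measurable (T : set (measurableTypeR R)).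
  by apply: (arc_param_measurable t01 gC gfin) => //; exact: measurable_box_cores.
have L0 : 0 <= L by rewrite fine_ge0// curve_length_ge0// ltW.
have Flip u v : t0 <= u -> u <= v -> v <= t1 ->
    `|potential e S (g v) - potential e S (g u)| <=
    fine (curve_length g t0 v) - fine (curve_length g t0 u).
  by apply: (potential_lipschitz disjS (ell := fun u => fine (curve_length g t0 u)) gC gS);
    exact: chord_le_arc.
have [F0 F1] := arc_param_ends t01 gC gfin Flip.
have osc : (`|potential e S (g t1) - potential e S (g t0)|%:E <= lebesgue_measure T)%E.
  rewrite -F0 -F1; apply: (@lipschitz_oscillation_le_measure _
    (potential e S \o arc) T
    (range (fun m => slit_corner (S m) ord0 ord0 + e * slit_length (S m)))) => //.
  - exact: (arc_param_lipschitz t01 gC gfin Flip).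
  - exact: subIsetl.
  - exact: card_image_le.
  - move=> t tL; have [[m tm]|tN] := pselect (exists m, core e (S m) (arc t)).
      right; exists m => //=.
      by rewrite (potential_wedge disjS (core_wedge tm)) core_tent.
    left; split; first by rewrite /= in_itv.
    split; last by move=> [m _ tm]; apply: tN; exists m.
    by rewrite /arc; have [u [u01 _ ->]] := arc_paramP t01 gC gfin tL; exact: gI.
rewrite EFinM; apply: le_trans (lee_wpmul2l _ osc) _; first by rewrite lee_fin.
rewrite (_ : lebesgue_measure T =
    (\int[lebesgue_measure]_(t in `[0%R, L]) (\1_T (t : measurableTypeR R))%:E)%E);
  last by rewrite integral_indic// setIidl// => t [].
rewrite -ge0_integralZl_EFin//; last by apply/measurable_EFinP; exact: measurable_indic.
rewrite le_eqVlt; apply/orP; left; apply/eqP; apply: eq_integral => t /set_mem tL.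
rewrite -EFinM /density !indicE; congr (_ * _)%:E; congr (_%:R).
congr (nat_of_bool _).
by apply/idP/idP; rewrite !inE; [case|].
Qed.

End segment.

End modulus_bound.

(** * Admissibility and the modulus bound *)

Section admissibility.
Context {R : realType} {n : nat}.
Local Notation V := 'rV[R]_n.+1.
Variables (a b : V) (S : nat -> slit R n) (e : R) (k : nat -> nat).
Hypotheses (n0 : (0 < n)%N) (ab : forall i, a ord0 i < b ord0 i) (e0 : 0 < e).
Hypothesis slitS : slit_sequence (open_box a b) S.
Hypothesis disjS : forall l m, l != m ->
  collar e (S (k l)) `&` collar e (S (k m)) = set0.

Local Notation A := (open_box a b `\` \bigcup_m core e (S (k m))).
Local Notation W := (b ord0 ord0 - a ord0 ord0).
Local Notation F := (potential e (S \o k)).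

Lemma potential_ge (z : V) : z ord0 ord0 <= F z.
Proof.
have [[j zj]|/potential_out->//] := pselect (exists j, wedge e ((S \o k) j) z).
by rewrite (potential_wedge disjS zj) ltW//; case/andP: zj.
Qed.

(** In a wedge the potential exceeds the first coordinate by at most [e l], and a
    wedge that meets the region close to the left face comes from a slit in this
    region, because it lies to the right of its slit. *)
Lemma potential_le (eta d : R) (z : V) : 0 <= eta ->
    (forall m, slit_corner (S m) ord0 ord0 < a ord0 ord0 + d ->
       slit_length (S m) < eta) ->
  z ord0 ord0 < a ord0 ord0 + d -> F z <= z ord0 ord0 + e * eta.
Proof.
move=> eta0 small zd.
have [[j zj]|/potential_out->] := pselect (exists j, wedge e ((S \o k) j) z); last first.
  by rewrite lerDl mulr_ge0// ltW.
rewrite (potential_wedge disjS zj) /tent.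
have /andP[xz _] := zj; apply: lerD; first exact: ltW.
have [h _] := (depth_geP e (S (k j)) (depth e (S (k j)) z) z).1 (lexx _).
by apply: le_trans h _; rewrite ler_pM2l// ltW// small// (lt_trans xz).
Qed.

Lemma density_admissible : admissible (curve_family a b S) (density W A).
Proof.
have W0 : 0 < W by rewrite subr_gt0.
have [SI _ S0 _] := slitS.
split.
- by move=> x; rewrite mulr_ge0// invr_ge0 ltW.
- apply: measurable_funM; first exact: measurable_cst.
  by apply: measurable_indic; exact: measurable_box_cores.
move=> g gG grect.
have [gC gI0 gconn] := gG 0%N I.
have gI t : 0 < t < 1 -> open_box a b (g t).
  by move=> t01; have [] : slit_domain a b S 0 (g t)
    by apply: gI0; exists t => //; rewrite /= in_itv.
have gS t j : 0 < t < 1 -> ~ slit_set (S j) (g t).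
  move=> t01 gtj; have [_ gIj _] := gG j I.
  have [_] : slit_domain a b S j (g t) by apply: gIj; exists t => //; rewrite /= in_itv.
  by apply; exists j => /=.
have aS m : a ord0 ord0 < slit_corner (S m) ord0 ord0.
  have /SI/(_ ord0)/andP[] // : slit_set (S m) (slit_corner (S m)).
  by split => // i _; rewrite lexx lerDl ltW// slit_length_gt0.
have segP t0 t1 : 0 < t0 -> t0 < t1 -> t1 < 1 ->
    ((W^-1 * `|F (g t1) - F (g t0)|)%:E <= line_integral (density W A) g)%E.
  move=> h0 h1 h2; apply: ereal_sup_ge.
  exists (line_integral_seg (density W A) g t0 t1).
    by exists (t0, t1) => //; split => //; exact: ltW.
  have sub t : t0 <= t <= t1 -> 0 < t < 1.
    by move=> /andP[h3 h4]; rewrite (lt_le_trans h0 h3) (le_lt_trans h4 h2).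
  apply: (potential_gap_le_integral disjS) => //.
  - by apply: continuous_subspaceW gC => t /=; rewrite !in_itv/=; exact: sub.
  - by apply: grect => //; exact: ltW.
  - by move=> t /sub; exact: gI.
  - by move=> t j /sub; exact: gS.
have segP' t0 t1 : 0 < t0 < 1 -> 0 < t1 < 1 -> F (g t0) < F (g t1) ->
    ((W^-1 * (F (g t1) - F (g t0)))%:E <= line_integral (density W A) g)%E.
  move=> /andP[h1 h2] /andP[h3 h4] Flt.
  have -> : F (g t1) - F (g t0) = `|F (g t1) - F (g t0)| by rewrite gtr0_norm ?subr_gt0.
  case: (ltgtP t0 t1) Flt => [t01 _|t10 _|->]; last by rewrite ltxx.
    exact: segP.
  by rewrite distrC segP.
apply/lee_mul01Pr => // r /andP[r0 r1]; rewrite mule1.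
(* The loss [(1 - r) * W] covers the excess [eta] of the potential over the first
   coordinate near the left face, and the distances of [g t0] and [g t1] to the
   two faces, which are less than [d' * 2 <= eta]. *)
pose eta := (1 - r) * W / 3.
have eta0 : 0 < eta by rewrite divr_gt0// mulr_gt0// subr_gt0.
have [d d0 small] := slits_near_face_small n0 aS S0 (divr_gt0 eta0 e0).
pose d' := Num.min (d / 2) (Num.min (eta / 2) (W / 2)).
have [d'0 d'd d'eta d'W] : [/\ 0 < d', d' * 2 <= d, d' * 2 <= eta & d' * 2 <= W].
  split; first by rewrite /d' !lt_min; apply/and3P; split; exact: divr_gt0.
  - by rewrite -ler_pdivlMr// /d' ge_min lexx.
  - by rewrite -ler_pdivlMr// /d' !ge_min lexx orbT.
  - by rewrite -ler_pdivlMr// /d' !ge_min lexx !orbT.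
have [t0 t001 g0] : exists2 t, 0 < t < 1 & `|a ord0 ord0 + d' - g t ord0 ord0| < d'.
  by apply: (connects_heights ab gconn _ d'0); apply/andP; split; lra.
have [t1 t101 g1] : exists2 t, 0 < t < 1 & `|b ord0 ord0 - d' - g t ord0 ord0| < d'.
  by apply: (connects_heights ab gconn _ d'0); apply/andP; split; lra.
move: g0 g1; rewrite !ltr_norml => /andP[g01 g02] /andP[g11 g12].
have F0 : F (g t0) <= g t0 ord0 ord0 + eta.
  have -> : eta = e * (eta / e) by rewrite mulrCA divff ?mulr1// gt_eqF.
  apply: potential_le small _; [by rewrite ltW// divr_gt0|lra].
have F1 := potential_ge (g t1).
have gap : r * W <= F (g t1) - F (g t0).
  have : eta * 3 = (1 - r) * W by rewrite /eta mulfVK.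
  by move=> ?; lra.
have rW : 0 < r * W by rewrite mulr_gt0.
apply: le_trans (segP' _ _ t001 t101 _); last by rewrite -subr_gt0 (lt_le_trans rW).
by rewrite lee_fin ler_pdivlMl// mulrC.
Qed.

End admissibility.

Unset Implicit Arguments.

Theorem lemma5p2 (R : realType) (n : nat) (hn : (2 <= n.+1)%N) :
  exists C : R, 0 < C /\
    forall (a b : 'rV[R]_n.+1) (S : nat -> slit R n) (e : R) (k : nat -> nat),
      (forall i, a ord0 i < b ord0 i) ->
      slit_sequence (open_box a b) S ->
      uniformly_rel_separated (open_box a b) S ->
      0 < e ->
      (forall l m, (l < m)%N -> (k l < k m)%N) ->
      (forall l m, l != m -> collar e (S (k l)) `&` collar e (S (k m)) = set0) ->
      forall p : R, 1 <= p ->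
        (modulus p (curve_family a b S) <=
         ((b ord0 ord0 - a ord0 ord0) `^ (- p))%:E *
         (lebesgue_rV (collar_complement a b S e k) +
          C%:E * lebesgue_rV (open_box a b) * e%:E))%E.
Proof.
exists n.*2%:R; split; first by rewrite ltr0n double_gt0.
move=> a b S e k ab slitS _ e0 _ disjS p p1.
have [SI _ _ _] := slitS.
apply: le_trans (modulus_le_volume _ p1 (measurable_box_cores a b e (S \o k))
  (density_admissible hn ab e0 slitS disjS)) _; first by rewrite subr_gt0.
apply: lee_wpmul2l; first by rewrite lee_fin powR_ge0.
by apply: (box_cores_volume e0 (S := S \o k)) => // m; exact: SI.
Qed.
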